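(* Let $V$ be a real vector space, $X\subseteq V$, and $L:=Co(V,X)$. The following are equivalent: (i) $L$ is topologically scattered (as a subspace of $\mathbf{2}^X$ with the product topology); (ii) $L$ is order-scattered; (iii) the join-semilattice $S$ of compact elements of $L$ is order-scattered and has no join-subsemilattice isomorphic to $\mathcal{P}^{<\omega}(\mathbb{N})$; (iv) $X$ is contained in a finite union of lines of $V$, and for each such line $\ell$, equipped with an orientation, the linear order induced on the points of $X\cap \ell$ is order-scattered.
   Context: $Co(V,X)$ is the family of sets $C\cap X$ with $C$ a convex subset of $V$, ordered by inclusion; it is the lattice of closed sets of the closure $Y\mapsto \mathrm{conv}(Y)\cap X$ on $X$, and its compact elements are the sets $\mathrm{conv}(F)\cap X$ with $F\subseteq X$ finite. $\mathcal{P}^{<\omega}(\mathbb{N})$ is the join-semilattice (under union) of finite subsets of $\mathbb{N}$. A poset is order-scattered if it contains no copy of the chain $\mathbb{Q}$. A topological space is (topologically) scattered if every non-empty subset has an isolated point (in the induced topology); $Co(V,X)$ is viewed as a subset of $\mathbf{2}^X\cong\mathcal{P}(X)$ with the product of discrete two-point spaces.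
   Formalization: The vector space V is assumed to be nonzero, since for V = {0} and X = {0} there are no lines, so (iv) fails while (i)–(iii) hold. *)

(* Defs.v *)
From HB Require Import structures.
From mathcomp Require Import all_boot all_order all_algebra.
From mathcomp Require Import all_classical all_reals.
From mathcomp Require Import topology convex.
Set Implicit Arguments. Unset Strict Implicit. Unset Printing Implicit Defensive.
Import Order.TTheory GRing.Theory Num.Theory.
Local Open Scope classical_set_scope.
Local Open Scope ring_scope.

Definition Co (R : realType) (V : lmodType R) (X : set V) : set (set V) :=
  [set A | exists C : set (convex_lmodType V), convex_set C /\ A = C `&` X].

Definition order_scattered (T : Type) (le : T -> T -> Prop) (P : set T) : Prop :=
  ~ exists f : rat -> T,
      (forall q, P (f q)) /\ (forall q r : rat, (q <= r)%R <-> le (f q) (f r)).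

(* Topological scatteredness of a family L of subsets of X, viewed as a
   subspace of 2^X with the product of discrete two-point spaces.  The basic
   open neighbourhoods of A ⊆ X in 2^X are the cylinders
   { B ⊆ X | F ⊆ B, B ∩ G = ∅ } with F, G finite subsets of X, F ⊆ A,
   A ∩ G = ∅.  A is isolated in S iff some such cylinder meets S only in A. *)
Definition cylinder (T : Type) (F G : set T) : set (set T) :=
  [set B | F `<=` B /\ B `&` G = set0].

Definition isolated_in (T : Type) (X : set T) (S : set (set T)) (A : set T) :=
  S A /\ exists F G : set T,
    [/\ finite_set F, finite_set G, F `<=` X, G `<=` X &
        [/\ cylinder F G A & forall B, S B -> cylinder F G B -> B = A]].

Definition top_scattered (T : Type) (X : set T) (L : set (set T)) : Prop :=
  forall S : set (set T), S `<=` L -> S !=set0 -> exists A, isolated_in X S A.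

Definition is_lub (T : Type) (P D : set (set T)) (s : set T) : Prop :=
  [/\ P s, (forall d, D d -> d `<=` s) &
      (forall u, P u -> (forall d, D d -> d `<=` u) -> s `<=` u)].

Definition compact_elt (T : Type) (P : set (set T)) (K : set T) : Prop :=
  P K /\ forall (D : set (set T)) (s : set T), D `<=` P -> is_lub P D s ->
    K `<=` s -> exists D' : set (set T),
      [/\ finite_set D', D' `<=` D & exists s', is_lub P D' s' /\ K `<=` s'].

Definition compact_elts (T : Type) (P : set (set T)) : set (set T) :=
  [set K | compact_elt P K].

Definition has_Pfin_nat (T : Type) (S : set (set T)) : Prop :=
  exists f : set nat -> set T,
    [/\ (forall A, finite_set A -> S (f A)),
        (forall A B, finite_set A -> finite_set B -> f A = f B -> A = B) &
        (forall A B, finite_set A -> finite_set B ->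
           is_lub S [set u | u = f A \/ u = f B] (f (A `|` B)))].

Definition line (R : realType) (V : lmodType R) (a v : V) : set V :=
  [set a + t *: v | t in [set: R]].

(* Condition (iv): X lies in a finite union of lines, and on each of them
   (oriented by its direction vector) the induced order on X ∩ line,
   i.e. the order of the parameters t with a + t v ∈ X, is scattered. *)
Definition finite_lines_scattered (R : realType) (V : lmodType R) (X : set V) :=
  exists s : seq (V * V),
    [/\ (forall p, p \in s -> p.2 != 0),
        X `<=` \bigcup_(p in [set p | p \in s]) line p.1 p.2 &
        (forall p, p \in s ->
           order_scattered (fun t u : R => t <= u) [set t : R | X (p.1 + t *: p.2)])].

(* Main.v *)
(* For (i) => (ii), a copy [f] of the rationals yields the members
   [g q = \bigcup_(r < q) f r], each of which is a limit of smaller ones.  For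
   (ii) => (iii), joins extend a copy of the finite subsets of nat to all subsets.

   For (iii) => (iv), a set that is not covered by finitely many flats of any
   fixed dimension contains an infinite linearly independent sequence.
   Otherwise some flat of dimension [k >= 2] meets the set in a part which is not
   covered by finitely many flats of dimension [k - 1]; an affine projection to
   the plane then carries infinitely many points in general position, and a
   Ramsey argument on orientations of triples extracts a sequence in convex
   position.  In all cases convex position gives a copy of the finite subsets of
   nat.  A copy of the rationals on a line gives a chain of segments sharing an
   endpoint.

   For (iv) => (i), a family of subsets of [A `|` B] is scattered if its traces
   on [A] and [B] are.  On a line, the members containing a given point split
   into two chains of traces on half-lines, and a chain of sets without isolated
   member yields a copy of the rationals. *)
Require Import Defs.
From HB Require Import structures.
From mathcomp Require Import all_boot all_order all_algebra.
From mathcomp Require Import all_classical all_reals.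
From mathcomp Require Import interval_inference topology convex.
From mathcomp Require Import ring lra.
Import Order.TTheory GRing.Theory Num.Theory.
Local Open Scope classical_set_scope.
Local Open Scope ring_scope.
Set Implicit Arguments. Unset Strict Implicit. Unset Printing Implicit Defensive.

(** * Convex hulls and the lattice Co(V, X) *)

Section ConvexHull.
Context {R : realType} {V : lmodType R}.
Implicit Types (A B C F X : set V) (x y : V).

Lemma convex_setP C :
  @convex_set R V C <->
  forall x y (t : R), 0 <= t -> t <= 1 -> C x -> C y -> C (t *: x + (1 - t) *: y).
Proof.
split=> [cC x y t t0 t1 Cx Cy | cC x y l /set_mem Cx /set_mem Cy].
  exact: (set_mem (cC x y (Itv01 t0 t1) (mem_set Cx) (mem_set Cy))).
by apply/mem_set/cC.
Qed.

Definition hull A : set V :=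
  [set x | forall C, @convex_set R V C -> A `<=` C -> C x].

Lemma hull_convex A : @convex_set R V (hull A).
Proof.
apply/convex_setP => x y t t0 t1 hx hy C cC AC.
by move/convex_setP: (cC); apply=> //; [exact: hx | exact: hy].
Qed.

Lemma sub_hull A : A `<=` hull A.
Proof. by move=> x Ax C _; apply. Qed.

Lemma hull_min A C : @convex_set R V C -> A `<=` C -> hull A `<=` C.
Proof. by move=> cC AC x; apply. Qed.

Lemma hullS A B : A `<=` B -> hull A `<=` hull B.
Proof.
by move=> AB; apply: hull_min; [exact: hull_convex | exact: subset_trans (@sub_hull B)].
Qed.

(** The points reached from finitely many points of [A] already form a convex set containing [A]. *)
Lemma hull_finite A x :
  hull A x -> exists F, [/\ finite_set F, F `<=` A & hull F x].
Proof.
apply: (@hull_min A [set x | exists F, [/\ finite_set F, F `<=` A & hull F x]]).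
  apply/convex_setP => y z t t0 t1 [F [finF FA hF]] [G [finG GA hG]].
  exists (F `|` G); split; first by rewrite finite_setU.
    by rewrite subUset.
  have /convex_setP := @hull_convex (F `|` G); apply=> //.
    by apply: hullS hF; exact: subsetUl.
  by apply: hullS hG; exact: subsetUr.
move=> y Ay; exists [set y]; split; first exact: finite_set1.
  by move=> z ->.
exact: sub_hull.
Qed.

(** Replaces an unspecified convex witness by the closed sets of a closure operator, the hull being
    the canonical witness. *)
Lemma CoP X A : Co X A <-> A `<=` X /\ hull A `&` X `<=` A.
Proof.
split=> [[C [cC ->]]|[AX hA]].
  split=> [x [] //|x [hx Xx]]; split=> //.
  by apply: (hull_min cC) hx => y [].
exists (hull A); split; first exact: hull_convex.
by apply/seteqP; split=> // x Ax; split; [exact: sub_hull | exact: AX].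
Qed.

Lemma Co_hull X A : Co X (hull A `&` X).
Proof. by exists (hull A); split=> //; exact: hull_convex. Qed.

(** Points in the hulls of two members lie in the hull of a common larger member, so the union of
    the hulls is convex. *)
Lemma Co_directed X (D : set (set V)) : D `<=` Co X ->
  (forall A B, D A -> D B -> exists C, [/\ D C, A `<=` C & B `<=` C]) ->
  Co X (\bigcup_(A in D) A).
Proof.
move=> DX dirD; exists [set x | exists2 A, D A & hull A x]; split.
  apply/convex_setP => x y t t0 t1 [A DA hx] [B DB hy].
  have [C [DC AC BC]] := dirD _ _ DA DB; exists C => //.
  have /convex_setP := @hull_convex C; apply=> //.
    exact: hullS hx.
  exact: hullS hy.
apply/seteqP; split=> x.
  move=> [A DA Ax]; split; first by exists A => //; exact: sub_hull.
  by have /CoP[+ _] := DX _ DA; apply.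
move=> [[A DA hx] Xx]; exists A => //.
by have /CoP[_] := DX _ DA; apply.
Qed.

Lemma Co_is_lub X (D : set (set V)) : D `<=` Co X ->
  is_lub (Co X) D (hull (\bigcup_(A in D) A) `&` X).
Proof.
move=> DX; split; first exact: Co_hull.
  move=> A DA x Ax; have /CoP[AX _] := DX _ DA; split; last exact: AX.
  by apply: sub_hull; exists A.
move=> U /CoP[_ hU] DU x [hx Xx]; apply: hU; split=> //.
by apply: hullS hx => y [A DA Ay]; exact: DU Ay.
Qed.

(** Each point of [F] lies in the hull of finitely many points of the union of [D], and each of
    those comes from one member of [D]; finitely many members thus suffice for all of [F]. *)
Lemma compact_hull X F : finite_set F -> F `<=` X ->
  compact_elts (Co X) (hull F `&` X).
Proof.
move=> finF FX; split; first exact: Co_hull.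
move=> D s DX [/CoP[sX hs] _ smin] Fs.
have FD y : F y -> exists2 D', finite_set D' /\ D' `<=` D &
    hull (\bigcup_(A in D') A) y.
  move=> Fy; have : s y by apply: Fs; split; [exact: sub_hull | exact: FX].
  have [lubX lubD _] := Co_is_lub DX.
  move=> /(smin _ lubX lubD) [/hull_finite [G [finG GD hG]] _].
  have /choice[h hP] z : exists B, G z -> D B /\ B z.
    have [Gz|nGz] := pselect (G z); last by exists set0.
    by have [B DB Bz] := GD _ Gz; exists B.
  exists (h @` G).
    split; first exact: finite_image.
    by move=> _ [z Gz <-]; have [] := hP _ Gz.
  by apply: hullS hG => z Gz; exists (h z); [exists z | have [] := hP _ Gz].
have /choice[h hP] y : exists D' : set (set V), F y ->
    (finite_set D' /\ D' `<=` D) /\ hull (\bigcup_(A in D') A) y.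
  have [Fy|nFy] := pselect (F y); last by exists set0.
  by have [D' ? ?] := FD _ Fy; exists D'.
have D'D : \bigcup_(y in F) h y `<=` D.
  by move=> A [y Fy]; have [[_ +] _] := hP _ Fy; apply.
exists (\bigcup_(y in F) h y); split=> //.
  by apply: bigcup_finite => // y Fy; have [[]] := hP _ Fy.
exists (hull (\bigcup_(A in \bigcup_(y in F) h y) A) `&` X); split.
  by apply: Co_is_lub => A /D'D /DX.
apply: setSI; apply: hull_min; first exact: hull_convex.
move=> y Fy; have [_] := hP _ Fy; apply: hullS => z [A hA Az].
by exists A => //; exists y.
Qed.

(** Equivalent to [x n] lying outside the hull of the other points, but phrased by the separating
    set that the constructions supply. *)
Definition convex_position (x : nat -> V) := forall n, exists C,
  [/\ @convex_set R V C, ~ C (x n) & forall m : nat, m != n -> C (x m)].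

(* Points in convex position generate a copy of the finite subsets of nat
   under [A |-> hull (x @` A) `&` X]. *)
Lemma convex_position_Pfin X (x : nat -> V) :
  (forall n, X (x n)) -> convex_position x ->
  has_Pfin_nat (compact_elts (Co X)).
Proof.
move=> Xx indep; pose f (A : set nat) := hull (x @` A) `&` X.
have imX (A : set nat) : x @` A `<=` X by move=> _ [n _ <-].
have fS (A : set nat) : finite_set A -> compact_elts (Co X) (f A).
  by move=> finA; apply: compact_hull; [exact: finite_image | exact: imX].
have mem_f n (A : set nat) : f A (x n) <-> A n.
  split=> [[hn _]|An]; last by split=> //; apply: sub_hull; exists n.
  apply: contrapT => nAn; have [C [cC nCn Cm]] := indep n.
  apply/nCn/(hull_min cC _ hn) => _ [m Am <-]; apply: Cm.
  by apply/eqP => mn; apply: nAn; rewrite -mn.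
exists f; split=> // [A B _ _ fAB|A B finA finB].
  by apply/seteqP; split=> n /mem_f fn; apply/mem_f; [rewrite -fAB | rewrite fAB].
split; first by apply: fS; rewrite finite_setU.
  by move=> _ [->|->]; apply: setSI; apply: hullS; apply: image_subset => n;
    [left | right].
move=> U [/CoP[UX hU] _] Uub z [hz Xz]; apply: hU; split=> //.
apply: hullS hz => _ [n ABn <-].
have [An|Bn] := ABn; first by apply: (Uub (f A)); [left | apply/mem_f].
by apply: (Uub (f B)); [right | apply/mem_f].
Qed.

End ConvexHull.

(** * Greedy constructions of sequences *)

(** The most recent term stands at the head, so that a greedy step is a cons. *)
Fixpoint past (T : Type) (u : nat -> T) (n : nat) : seq T :=
  if n is m.+1 then u m :: past u m else [::].

Lemma size_past (T : Type) (u : nat -> T) n : size (past u n) = n.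
Proof. by elim: n => //= n ->. Qed.

Lemma mem_past (T : eqType) (u : nat -> T) i n : (i < n)%N -> u i \in past u n.
Proof.
elim: n => // n IH; rewrite ltnS leq_eqVlt inE => /orP[/eqP->|/IH->].
  by rewrite eqxx.
by rewrite orbT.
Qed.

(** Dependent choice on histories: a function choosing the next term is iterated from the empty
    list. *)
Lemma greedy_sequence (T : Type) (good : seq T -> Prop) :
  good [::] -> (forall s, good s -> exists x, good (x :: s)) ->
  exists u : nat -> T, forall n, good (past u n).
Proof.
move=> good0 goodS; have [x0 _] := goodS _ good0.
have /choice[f fP] s : exists x, good s -> good (x :: s).
  have [gs|ngs] := pselect (good s); last by exists x0.
  by have [x ?] := goodS _ gs; exists x.
pose st n := iter n (fun s => f s :: s) [::].
have pastE n : past (f \o st) n = st n by elim: n => //= n ->.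
by exists (f \o st) => n; rewrite pastE; elim: n => //= n /fP.
Qed.

(* Cantor's embedding of the rationals, for a dense strict relation [r]
   compatible with a total preorder [le]. *)
Lemma rat_embedding (T : eqType) (le r : T -> T -> Prop) (a b : T) :
  (forall x y, le x y \/ le y x) -> (forall x y z, le x y -> le y z -> le x z) ->
  (forall x y z, le x y -> r y z -> r x z) ->
  (forall x y z, r x y -> le y z -> r x z) ->
  (forall x y, r x y -> exists z, r x z /\ r z y) ->
  r a b -> exists f : rat -> T, forall p q, p < q -> r (f p) (f q).
Proof.
move=> le_total le_trans le_r r_le r_dense rab.
have le_refl x : le x x by case: (le_total x x).
have ex_max c s : exists2 m, m \in c :: s & forall x, x \in c :: s -> le x m.
  elim: s c => [|y s IH] c.
    by exists c => [|x]; rewrite !inE ?eqxx // => /eqP->.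
  have [m ms mP] := IH y; have [cm|mc] := le_total c m.
    exists m; first by rewrite inE ms orbT.
    by move=> x; rewrite inE => /orP[/eqP->//|/mP].
  exists c; first by rewrite inE eqxx.
  move=> x; rewrite inE => /orP[/eqP->//|/mP xm]; exact: le_trans xm mc.
have ex_min c s : exists2 m, m \in c :: s & forall x, x \in c :: s -> le m x.
  elim: s c => [|y s IH] c.
    by exists c => [|x]; rewrite !inE ?eqxx // => /eqP->.
  have [m ms mP] := IH y; have [cm|mc] := le_total c m; last first.
    exists m; first by rewrite inE ms orbT.
    by move=> x; rewrite inE => /orP[/eqP->//|/mP].
  exists c; first by rewrite inE eqxx.
  move=> x; rewrite inE => /orP[/eqP->//|/mP xm]; exact: le_trans cm xm.
(* An enumeration of [rat]. Indices that code nothing yield 0, and such repetitions are harmless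
   because [good] only constrains pairs of distinct rationals. *)
pose e n : rat := odflt 0 (unpickle n).
pose good (s : seq (rat * T)) := [/\ [seq p.1 | p <- s] = past e (size s),
  (forall p, p \in s -> r a p.2 /\ r p.2 b) &
  (forall p q, p \in s -> q \in s -> p.1 < q.1 -> r p.2 q.2)].
have [//|s [sE sab sr]|u goodu] := @greedy_sequence _ good.
  set q := e (size s).
  (* The new value must fit between those given to smaller and to larger rationals; [a] and [b] keep
     both lists non-empty. *)
  have [m ms mP] := ex_max a [seq p.2 | p <- s & p.1 < q].
  have [n ns nP] := ex_min b [seq p.2 | p <- s & q < p.1].
  have rmn : r m n.
    move: ms ns; rewrite !inE => ms ns.
    case/orP: ms => [/eqP->|/mapP[p1 + ->]]; case/orP: ns => [/eqP->//|/mapP[p2 + ->]].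
    - by rewrite mem_filter => /andP[_ /sab[]].
    - by rewrite mem_filter => /andP[_ /sab[]].
    - rewrite !mem_filter => /andP[qp2 p2s] /andP[p1q p1s].
      exact: sr (lt_trans p1q qp2).
  have [z [rmz rzn]] := r_dense _ _ rmn.
  have lo p : p \in s -> p.1 < q -> r p.2 z.
    move=> ps pq; apply: le_r rmz; apply: mP; rewrite inE; apply/orP; right.
    by apply/mapP; exists p => //; rewrite mem_filter pq.
  have hi p : p \in s -> q < p.1 -> r z p.2.
    move=> ps pq; apply: r_le rzn _; apply: nP; rewrite inE; apply/orP; right.
    by apply/mapP; exists p => //; rewrite mem_filter pq.
  exists (q, z); split; first by rewrite /= sE.
  - move=> p; rewrite inE => /orP[/eqP->/=|/sab//]; split.
      by apply: le_r rmz; apply: mP; rewrite inE eqxx.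
    by apply: r_le rzn _; apply: nP; rewrite inE eqxx.
  - move=> p1 p2; rewrite !inE => /orP[/eqP->|p1s] /orP[/eqP->|p2s] //=.
    + by rewrite ltxx.
    + exact: hi.
    + exact: lo.
    + exact: sr.
exists (fun q => (u (pickle q)).2) => p q pq.
have u1 x : (u (pickle x)).1 = x.
  have [] := goodu (pickle x).+1; rewrite /= size_past => -[-> _] _ _.
  by rewrite /e pickleK.
have [_ _] := goodu (maxn (pickle p) (pickle q)).+1; apply.
- by apply: mem_past; rewrite ltnS leq_maxl.
- by apply: mem_past; rewrite ltnS leq_maxr.
- by rewrite !u1.
Qed.

(** * Topological scatteredness of families of sets *)

(* If no member is isolated, then two members with a third strictly in between
   have infinitely many in between, so that "having a member strictly in between"
   is a dense relation on the chain. *)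
Lemma chain_no_isolated (T : eqType) (X : set T) (S : set (set T)) :
  (forall A, S A -> A `<=` X) -> S !=set0 ->
  (forall A B, S A -> S B -> A `<=` B \/ B `<=` A) ->
  (~ exists A, isolated_in X S A) ->
  exists f : rat -> T, (forall q, X (f q)) /\
    forall p q, p < q -> exists2 A, S A & A (f p) /\ ~ A (f q).
Proof.
move=> SX [A0 SA0] chainS niso.
have no_iso A F G : S A -> finite_set F -> finite_set G -> F `<=` X ->
    G `<=` X -> cylinder F G A -> exists B, [/\ S B, cylinder F G B & B <> A].
  move=> SA finF finG FX GX cA; apply: contrapT => nex; apply: niso.
  exists A; split=> //; exists F, G; split=> //; split=> // B SB cB.
  by apply: contrapT => BA; apply: nex; exists B.
pose below (A B : set T) := exists x, B x /\ ~ A x.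
have belowW A B : S A -> S B -> below A B -> A `<=` B.
  by move=> SA SB [x [Bx nAx]]; have [//|/(_ _ Bx)/nAx] := chainS _ _ SA SB.
have below_or A B : S A -> S B -> A <> B -> below A B \/ below B A.
  move=> SA SB AB; apply: contrapT => /not_orP[nAB nBA]; apply: AB.
  apply/seteqP; split=> x ?; apply: contrapT => ?; [apply: nBA | apply: nAB];
    by exists x.
have below_trans A B C : S A -> S B -> S C -> below A B -> below B C -> below A C.
  move=> SA SB SC AB [x [Cx nBx]]; exists x; split=> // Ax.
  exact/nBx/(belowW _ _ SA SB AB).
(* Requiring a point of [C] outside [A] and forbidding a point of [B] outside [C] confines the
   cylinder to members strictly between [A] and [B]. *)
have other A C B : S A -> S B -> S C -> below A C -> below C B ->
    exists C', [/\ S C', C' <> C, below A C' & below C' B].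
  move=> SA SB SC [x [Cx nAx]] [y [By nCy]].
  have [|||||C' [SC' [xC' yC'] C'C]] := no_iso C [set x] [set y] SC.
  - exact: finite_set1.
  - exact: finite_set1.
  - by move=> _ ->; exact: SX Cx.
  - by move=> _ ->; exact: SX By.
  - by split=> [_ ->//|]; apply/seteqP; split=> // z [Cz /= zy]; apply: nCy;
      rewrite -zy.
  exists C'; split=> //; first by exists x; split=> //; exact: xC'.
  exists y; split=> // C'y; suff : (C' `&` [set y]) y by rewrite yC'.
  by [].
pose ll (A B : set T) := exists C, [/\ S C, below A C & below C B].
have two A B : S A -> S B -> ll A B ->
    exists C1 C2, [/\ S C1, S C2, below A C1, below C1 C2 & below C2 B].
  move=> SA SB [C [SC lAC CB]].
  have [C' [SC' C'C lAC' C'B]] := other _ _ _ SA SB SC lAC CB.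
  have [CC'|C'C2] := below_or _ _ SC' SC C'C; first by exists C', C.
  by exists C, C'.
have llW A B : S A -> S B -> ll A B -> below A B.
  by move=> SA SB [C [SC lAC CB]]; exact: (below_trans _ _ _ SA SC SB lAC CB).
have dense A B : S A -> S B -> ll A B -> exists D, [/\ S D, ll A D & ll D B].
  move=> SA SB AB; have [C1 [C2 [SC1 SC2 AC1 C12 C2B]]] := two _ _ SA SB AB.
  have [|D1 [D2 [SD1 SD2 AD1 D12 D2C]]] := two A C2 SA SC2; first by exists C1.
  by exists D2; split=> //; [exists D1 | exists C2].
(* The empty cylinder gives a second member, hence a pair with [A] below [B]; forbidding a point of
   [B] outside [A] then gives a third member below [B], on either side of [A]. *)
have [A1 [B1 [SA1 SB1 AB1]]] : exists A B, [/\ S A, S B & ll A B].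
  have [|||||B0 [SB0 _ BA0]] := no_iso A0 set0 set0 SA0 => //.
    by split=> //; rewrite setI0.
  have [A [B [SA SB AB]]] : exists A B, [/\ S A, S B & below A B].
    by have [?|?] := below_or _ _ SB0 SA0 BA0; [exists B0, A0 | exists A0, B0].
  have [y [By nAy]] := AB.
  have [|||||C [SC [_ Cy] CA]] := no_iso A set0 [set y] SA => //.
    by move=> _ ->; exact: SX By.
    by split=> //; apply/seteqP; split=> // z [Az /= zy]; apply: nAy; rewrite -zy.
  have CB : below C B.
    exists y; split=> // Cy'; suff : (C `&` [set y]) y by rewrite Cy.
    by [].
  have [?|?] := below_or _ _ SC SA CA; first by exists C, B; split=> //; exists A.
  by exists A, B; split=> //; exists C.
(* Density passes from members to points: [le] compares points by the members containing them, and
   [r x y] asks for an [ll] pair whose smaller member contains [x] and whose larger one misses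
   [y]. *)
pose le x y := forall A, S A -> A y -> A x.
pose r x y := exists A B, [/\ S A, S B, A x, ~ B y & ll A B].
have [x0 [y0 rxy0]] : exists x y, r x y.
  have [D [SD AD DB]] := dense _ _ SA1 SB1 AB1.
  have [C1 [C2 [SC1 SC2 AC1 C12 C2D]]] := two _ _ SA1 SD AD.
  have [E1 [E2 [SE1 SE2 DE1 E12 E2B]]] := two _ _ SD SB1 DB.
  have [x [Cx _]] := AC1; have [y [_ nEy]] := E12.
  exists x, y, C1, E1; split=> //; exists C2; split=> //.
  exact: (below_trans _ _ _ SC2 SD SE1 C2D DE1).
have [|||||f rf] := @rat_embedding T le r x0 y0 _ _ _ _ _ rxy0.
- move=> x y; apply: contrapT => /not_orP[/existsNP[A /not_implyP[SA]]].
  move=> /not_implyP[Ay nAx] /existsNP[B /not_implyP[SB /not_implyP[Bx nBy]]].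
  by have [/(_ _ Ay)|/(_ _ Bx)] := chainS _ _ SA SB.
- by move=> x y z xy yz A SA /yz-/(_ SA)/xy; apply.
- by move=> x y z xy [A [B [SA SB Ay nBz AB]]]; exists A, B; split=> //; apply: xy.
- move=> x y z [A [B [SA SB Ax nBy AB]]] yz; exists A, B; split=> // Bz.
  exact: nBy (yz _ SB Bz).
- move=> x y [A [B [SA SB Ax nBy AB]]].
  have [D [SD AD DB]] := dense _ _ SA SB AB.
  (* After a second interpolation, a point of [D'] outside [D] is separated from [x] by [A], [D] and
     from [y] by [D'], [B]. *)
  have [D' [SD' DD' D'B]] := dense _ _ SD SB DB.
  have [z [D'z nDz]] := llW _ _ SD SD' DD'.
  by exists z; split; [exists A, D | exists D', B].
have fP p q : p < q -> exists2 A, S A & A (f p) /\ ~ A (f q).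
  move=> /rf[A [B [SA SB Ap nBq AB]]]; exists A => //; split=> // Aq.
  exact/nBq/(belowW _ _ SA SB (llW _ _ SA SB AB)).
exists f; split=> // q.
have /fP[A SA [Aq _]] : q < q + 1 by rewrite ltrDl.
exact: SX Aq.
Qed.

Lemma top_scatteredS (T : Type) (X : set T) (L L' : set (set T)) :
  L `<=` L' -> top_scattered X L' -> top_scattered X L.
Proof. by move=> LL' sL' S SL; apply: sL'; exact: subset_trans SL LL'. Qed.

(* A member isolated by its trace on [A], and then by its trace on [B] among the
   members with that trace on [A]. *)
Lemma top_scatteredU (T : Type) (A B : set T) (L : set (set T)) :
  (forall C, L C -> C `<=` A `|` B) ->
  top_scattered A [set C `&` A | C in L] ->
  top_scattered B [set C `&` B | C in L] ->
  top_scattered (A `|` B) L.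
Proof.
move=> LAB sA sB S SL [C0 SC0].
have [||_ [[C1 SC1 <-] [F [G [finF finG FA GA [[FC1 GC1] C1P]]]]]] :=
    sA [set C `&` A | C in S].
- by move=> _ [C /SL LC <-]; exists C.
- by exists (C0 `&` A), C0.
have [||_ [[C2 [SC2 C21] <-] [F' [G' [finF' finG' F'B G'B [[F'C G'C] C2P]]]]]] :=
    sB [set C `&` B | C in [set C | S C /\ C `&` A = C1 `&` A]].
- by move=> _ [C [/SL LC _] <-]; exists C.
- by exists (C1 `&` B), C1.
exists C2; split=> //; exists (F `|` F'), (G `|` G'); split.
- by rewrite finite_setU.
- by rewrite finite_setU.
- by apply: setUSS.
- by apply: setUSS.
have FC2 : F `<=` C2 by move=> x /FC1; rewrite -C21 => -[].
have F'C2 : F' `<=` C2 by move=> x /F'C[].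
have capE (E C H : set T) : H `<=` E -> (C `&` E) `&` H = C `&` H.
  by move=> HE; rewrite -setIA (setIidr HE).
split.
  split; first by rewrite subUset.
  by rewrite setIUr -(capE A C2 G GA) -(capE B C2 G' G'B) C21 GC1 G'C setU0.
move=> C SC [FF'C GG'C].
have CA : C `&` A = C1 `&` A.
  apply: C1P; first by exists C.
  split; first by move=> x Fx; split; [apply: FF'C; left | exact: FA].
  rewrite capE //; apply/seteqP; split=> // x [Cx Gx].
  by rewrite -GG'C; split=> //; left.
have CB : C `&` B = C2 `&` B.
  apply: C2P; first by exists C.
  split; first by move=> x Fx; split; [apply: FF'C; right | exact: F'B].
  rewrite capE //; apply/seteqP; split=> // x [Cx Gx].
  by rewrite -GG'C; split=> //; right.
rewrite -[C](setIidl (LAB _ (SL _ SC))) -[C2](setIidl (LAB _ (SL _ SC2))).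
by rewrite !setIUr CA CB C21.
Qed.

(** * Scatteredness of Co(V, X) *)

Section Scattered.
Context {R : realType} {V : lmodType R}.
Implicit Types (X C : set V).

Lemma top_scattered_order X :
  top_scattered X (Co X) -> order_scattered (@subset V) (Co X).
Proof.
move=> sX [f [fX fle]]; pose g q := \bigcup_(r in [set r | r < q]) f r.
have fS q r : q <= r -> f q `<=` f r by move=> /fle.
have gS q r : q <= r -> g q `<=` g r.
  by move=> qr x [p /= pq fx]; exists p => //=; exact: lt_le_trans qr.
have gX q : Co X (g q).
  rewrite /g -(bigcup_image [set r | r < q] f id); apply: Co_directed.
    by move=> _ [r _ <-].
  move=> _ _ [p pq <-] [r rq <-]; have [pr|/ltW rp] := leP p r.
    by exists (f r); split; [exists r | exact: fS | exact: fS].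
  by exists (f p); split; [exists p | exact: fS | exact: fS].
have gf q : g q `<=` f q by move=> x [p /= /ltW/fS]; apply.
have fg q r : q < r -> f q `<=` g r by move=> qr x fx; exists q.
have [||_ [[q _ <-] [F [G [finF _ _ _ [[Fg gG] iso]]]]]] := sX (range g).
- by move=> _ [q _ <-].
- by exists (g 0), 0.
(* As the family increases, the finite set [F] is already contained in a single [f p] with
   [p < q]. *)
have {}finF : exists2 p, p < q & F `<=` f p.
  have /finite_seqP[s Fs] := finF; rewrite Fs in Fg * => {F finF iso Fs}.
  elim: s Fg => [|x s IH] Fg; first by exists (q - 1) => //; lra.
  have [|p pq sp] := IH; first by move=> y ys; apply: Fg; rewrite /= inE ys orbT.
  have [r /= rq frx] : g q x by apply: Fg; rewrite /= inE eqxx.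
  exists (Order.max p r); first by rewrite gt_max pq rq.
  move=> y /=; rewrite inE => /orP[/eqP->|/sp].
    by apply: fS frx; rewrite le_max lexx orbT.
  by apply: fS; rewrite le_max lexx.
(* [g r] falls into the cylinder isolating [g q], so they are equal; then [f r'] lies in
   [g q = g r], hence in [f r], against [r < r']. *)
have [p pq Ff] := finF; pose r := (p + q) / 2; pose r' := (r + q) / 2.
have pr : p < r by rewrite /r; lra.
have rr' : r < r' by rewrite /r' /r; lra.
have r'q : r' < q by rewrite /r' /r; lra.
suff : r' <= r by rewrite leNgt rr'.
apply/fle; apply: subset_trans (fg _ _ r'q) _; rewrite -(iso (g r)); first exact: gf.
  by exists r.
split; first exact: subset_trans Ff (fg _ _ pr).
apply/seteqP; split=> // x [gx Gx]; rewrite -gG; split=> //.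
by apply: gS gx; rewrite ltW // (lt_trans rr').
Qed.

(* Joins turn a copy of the finite subsets of nat into a copy of all subsets,
   among which the initial segments of an enumeration of [rat] form a dense chain. *)
Lemma order_scattered_no_Pfin X :
  order_scattered (@subset V) (Co X) -> ~ has_Pfin_nat (compact_elts (Co X)).
Proof.
move=> sL [f [fS f_inj f_lub]].
have fX A : finite_set A -> Co X (f A) by move=> /fS[].
have f_mono A B : finite_set A -> finite_set B -> A `<=` B -> f A `<=` f B.
  move=> finA finB /setUidPr AB; have [_ ub _] := f_lub _ _ finA finB.
  by rewrite -[in f B]AB; apply: ub; left.
pose D B := [set f A | A in [set A | finite_set A /\ A `<=` B]].
pose h B := \bigcup_(K in D B) K.
have DX B : D B `<=` Co X by move=> _ [A [finA _] <-]; exact: fX.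
have dirD B K1 K2 : D B K1 -> D B K2 ->
    exists K, [/\ D B K, K1 `<=` K & K2 `<=` K].
  move=> [A1 [fin1 A1B] <-] [A2 [fin2 A2B] <-].
  have fin12 : finite_set (A1 `|` A2) by rewrite finite_setU.
  exists (f (A1 `|` A2)); split.
  - by exists (A1 `|` A2) => //; split=> //; rewrite subUset.
  - exact: f_mono (@subsetUl _ _ _).
  - exact: f_mono (@subsetUr _ _ _).
have hX B : Co X (h B) by apply: Co_directed; [exact: DX | exact: dirD].
have hS A B : A `<=` B -> h A `<=` h B.
  by move=> AB x [_ [C [finC CA] <-] fx]; exists (f C) => //; exists C => //;
    split=> //; exact: subset_trans AB.
have lub_h B : is_lub (Co X) (D B) (h B).
  split=> //; first by move=> K DK x Kx; exists K.
  by move=> U _ ub x [K /ub KU]; exact: KU.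
(* Compactness puts [f [set n]] below a single [f A] with [A] a finite part of [B]; their join is
   then [f A] itself, and injectivity forces [n] into [A]. *)
have mem_h n B : f [set n] `<=` h B -> B n.
  have fin_n : finite_set [set n] by exact: finite_set1.
  move=> fnB; have [_ /(_ _ _ (DX B) (lub_h B) fnB)] := fS _ fin_n.
  move=> [D' [finD' D'D [s [[_ _ smin] fns]]]].
  have [K [DK D'K]] : exists K, D B K /\ forall K', D' K' -> K' `<=` K.
    have /finite_seqP[s' D's'] := finD'.
    rewrite D's' in D'D * => {D' finD' smin D's'}.
    elim: s' D'D => [|K s' IH] D'D.
      exists (f set0); split=> //; exists set0 => //; split=> //; exact: finite_set0.
    have [|K1 [DK1 sK1]] := IH; first by move=> y ys; apply: D'D; rewrite /= inE ys orbT.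
    have DK : D B K by apply: D'D; rewrite /= inE eqxx.
    have [K2 [DK2 K12 KK2]] := dirD _ _ _ DK1 DK.
    exists K2; split=> // K' /=; rewrite inE => /orP[/eqP->//|/sK1 K'1].
    exact: subset_trans K'1 K12.
  have [A [finA AB] fAK] := DK.
  have fnA : f [set n] `<=` f A.
    by apply: subset_trans fns _; rewrite fAK; apply: smin D'K; exact: DX DK.
  apply: AB; suff -> : A = [set n] `|` A by left.
  have fin_nA : finite_set ([set n] `|` A) by rewrite finite_setU.
  apply: f_inj => //; apply/seteqP; split; first exact: f_mono (@subsetUr _ _ _).
  have [_ _] := f_lub _ _ fin_n finA; apply; first exact: fS.
  by move=> _ [->|->].
apply: sL; exists (fun q : rat => h [set n | exists2 r : rat, r < q & n = pickle r]).
split=> // q r; split=> [qr|qr].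
  by apply: hS => n [p pq ->]; exists p => //; exact: lt_le_trans qr.
rewrite leNgt; apply/negP => rq.
have : f [set pickle r] `<=` h [set n | exists2 r0 : rat, r0 < r & n = pickle r0].
  apply: subset_trans qr => x fx; exists (f [set pickle r]) => //.
  exists [set pickle r] => //; split; first exact: finite_set1.
  by move=> _ ->; exists r.
move=> /mem_h[p + /(pcan_inj pickleK) rp].
by rewrite rp ltxx.
Qed.

(** Shows that a member through [x] traces an initial segment of the points of [X] on each ray from
    [x]. *)
Lemma Co_segment X C (x w : V) (s t : R) : Co X C -> C x -> C (x + s *: w) ->
  0 <= t -> t <= s -> X (x + t *: w) -> C (x + t *: w).
Proof.
move=> /CoP[_ hC] Cx Cs t0 ts Xt; apply: hC; split=> //.
have [s0|s_neq0] := eqVneq s 0.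
  have -> : t = 0 by lra.
  by rewrite scale0r addr0; exact: sub_hull.
have s0 : 0 < s by rewrite lt_neqAle eq_sym s_neq0 (le_trans t0).
have -> : x + t *: w = (t / s) *: (x + s *: w) + (1 - t / s) *: x.
  by rewrite scalerDr scalerA divfK // addrAC -scalerDl [t / s + _]addrC subrK scale1r.
have /convex_setP := @hull_convex _ _ C; apply.
- by rewrite divr_ge0 // ltW.
- by rewrite ler_pdivrMr // mul1r.
- exact: sub_hull.
- exact: sub_hull.
Qed.

(** The traces are initial segments of the ray, hence a chain; points that these traces separate in
    the order of [rat] have increasing parameters. *)
Lemma ray_top_scattered X (x w : V) (Y := X `&` [set x + t *: w | t in [set t : R | 0 <= t]]) :
  order_scattered (fun t u : R => t <= u) [set t : R | X (x + t *: w)] ->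
  top_scattered Y [set C `&` Y | C in [set C | Co X C /\ C x]].
Proof.
move=> sY S SL S0; apply: contrapT => niso; apply: sY.
have [|A B /SL[C [CX Cx] <-] /SL[D [DX Dx] <-]|f [fY f_sep]] :=
    chain_no_isolated _ S0 _ niso.
- by move=> A /SL[C _ <-]; exact: subIsetr.
- apply: contrapT => /not_orP[/existsNP[y /not_implyP[[Cy [Xy [s s0 ys]]] nDy]]].
  move=> /existsNP[z /not_implyP[[Dz [Xz [t t0 zt]]] nCz]].
  rewrite -{}ys -{}zt in Cy Xy nDy Dz Xz nCz.
  have [st|/ltW ts] := leP s t.
    by apply: nDy; split; [exact: (Co_segment DX Dx Dz s0 st Xy) | split=> //; exists s].
  by apply: nCz; split; [exact: (Co_segment CX Cx Cy t0 ts Xz) | split=> //; exists t].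
have /choice[g gP] q : exists t : R, 0 <= t /\ x + t *: w = f q.
  by have [_ [t t0 <-]] := fY q; exists t.
have Xg q : X (x + g q *: w) by have [_ ->] := gP q; have [] := fY q.
exists g; split=> // q r; rewrite le_mono // => {q r} q r qr.
have [_ /SL[C [CX Cx] <-] [[Cq _] nCr]] := f_sep q r qr.
rewrite ltNge; apply/negP => gr; apply: nCr; split; last exact: fY.
have [r0 gr'] := gP r; rewrite -gr'; apply: (Co_segment CX Cx _ r0 gr) => //.
by have [_ ->] := gP q.
Qed.

Lemma line_top_scattered X (a v : V) (Y := X `&` line a v) :
  order_scattered (fun t u : R => t <= u) [set t : R | X (a + t *: v)] ->
  top_scattered Y [set C `&` Y | C in Co X].
Proof.
move=> sY S SL [C0 SC0].
(* If every member of [S] is empty, there is only one and it is isolated; otherwise a point [x0] of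
   some member cuts the line into two rays. *)
have [[x0 [C1 SC1 C1x0]]|nex] := pselect (exists x, exists2 C, S C & C x); last first.
  have S0 C : S C -> C = set0.
    by move=> SC; apply/seteqP; split=> // x Cx; case: nex; exists x; exists C.
  exists C0; split=> //; exists set0, set0; split=> //; split.
    by split; rewrite ?setI0 // => ? [].
  by move=> B SB _; rewrite (S0 _ SB) (S0 _ SC0).
have [t0 _ x0E] : line a v x0 by have [C _ C1E] := SL _ SC1; move: C1x0; rewrite -C1E => -[_ []].
have Yrays : Y = (X `&` [set x0 + t *: v | t in [set t : R | 0 <= t]]) `|`
                 (X `&` [set x0 + t *: (- v) | t in [set t : R | 0 <= t]]).
  rewrite -setIUr; congr (_ `&` _); apply/seteqP; split=> x.
    move=> [t _ <-]; have [tt|/ltW tt] := leP t0 t.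
      left; exists (t - t0); first by rewrite /= subr_ge0.
      by rewrite -x0E -addrA -scalerDl [t0 + _]addrC subrK.
    right; exists (t0 - t); first by rewrite /= subr_ge0.
    by rewrite -x0E scalerN -addrA -scalerBl subKr.
  move=> [[t _ <-]|[t _ <-]].
    by exists (t0 + t) => //; rewrite -x0E -addrA -scalerDl.
  by exists (t0 - t) => //; rewrite -x0E scalerN -addrA -scalerBl.
have scatL : top_scattered Y [set C `&` Y | C in [set C | Co X C /\ C x0]].
  rewrite Yrays; apply: top_scatteredU.
  - by move=> _ [C _ <-]; exact: subIsetr.
  - apply: top_scatteredS; last first.
      apply: ray_top_scattered => -[f [fX fle]]; apply: sY.
      exists (fun q => t0 + f q); split=> [q|q r]; last by rewrite lerD2l.
      by have := fX q; rewrite /= -x0E -addrA -scalerDl.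
    move=> _ [_ [C CX <-] <-]; exists C => //.
    by rewrite -setIA (setIidr (@subsetUl _ _ _)).
  - apply: top_scatteredS; last first.
      apply: ray_top_scattered => -[f [fX fle]]; apply: sY.
      (* The opposite ray reverses the order of parameters, so the copy of [rat] is reflected on
         both sides. *)
      exists (fun q => t0 - f (- q)); split=> [q|q r].
        by have := fX (- q); rewrite /= -x0E scalerN -addrA -scalerBl.
      by rewrite lerD2l lerN2; split=> [qr|/fle]; [apply/fle | ]; rewrite lerN2.
    move=> _ [_ [C CX <-] <-]; exists C => //.
    by rewrite -setIA (setIidr (@subsetUr _ _ _)).
have [||B [[SB Bx0] [F [G [finF finG FY GY [[FB BG] iso]]]]]] :=
    scatL [set C | S C /\ C x0].
- move=> D [/SL[C CX CD] Dx0]; exists C => //; split=> //.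
  by move: Dx0; rewrite -CD => -[].
- by exists C1.
have Yx0 : Y x0 by have [C _ BE] := SL _ SB; move: Bx0; rewrite -BE => -[].
(* Adding [x0] to the required points restricts the cylinder to members through [x0], among which
   [B] is isolated. *)
exists B; split=> //; exists (x0 |` F), G; split=> //.
- by rewrite finite_setU; split.
- by rewrite subUset; split=> // _ ->.
split; first by split=> //; rewrite subUset; split=> // _ ->.
move=> C SC []; rewrite subUset => -[Cx0 FC] CG; apply: iso => //.
by split=> //; exact: Cx0.
Qed.

Lemma lines_top_scattered X : finite_lines_scattered X -> top_scattered X (Co X).
Proof.
move=> [s [_ Xs sX]].
(* The covering is moved into the traces, so that the induction on [s] can remove a line. *)
suff sY : top_scattered (X `&` \bigcup_(p in [set p | p \in s]) line p.1 p.2)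
    [set C `&` (X `&` \bigcup_(p in [set p | p \in s]) line p.1 p.2) | C in Co X].
  rewrite (setIidl Xs) in sY; apply: top_scatteredS sY => C CX.
  by exists C => //; apply: setIidl; have /CoP[] := CX.
elim: s {Xs} sX => [|p s IH] sX.
  move=> S SL [A SA]; have S0 C : S C -> C = set0.
    by move=> /SL[D _ <-]; apply/seteqP; split=> // x [_ [_ []]].
  exists A; split=> //; exists set0, set0; split=> //; split.
    by split; rewrite ?setI0 // => ? [].
  by move=> B SB _; rewrite (S0 _ SB) (S0 _ SA).
have -> : X `&` \bigcup_(q in [set q | q \in p :: s]) line q.1 q.2 =
    (X `&` line p.1 p.2) `|` (X `&` \bigcup_(q in [set q | q \in s]) line q.1 q.2).
  rewrite -setIUr; congr (_ `&` _); apply/seteqP; split=> x.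
    by move=> [q /=]; rewrite inE => /orP[/eqP->|qs] lx; [left | right; exists q].
  by move=> [lx|[q /= qs lx]]; [exists p | exists q] => //=; rewrite inE ?eqxx ?qs ?orbT.
apply: top_scatteredU.
- by move=> _ [C _ <-]; exact: subIsetr.
- apply: top_scatteredS (line_top_scattered _).
    move=> _ [_ [C CX <-] <-]; exists C => //.
    by rewrite -setIA (setIidr (@subsetUl _ _ _)).
  by apply: sX; rewrite inE eqxx.
- apply: top_scatteredS (IH _).
    move=> _ [_ [C CX <-] <-]; exists C => //.
    by rewrite -setIA (setIidr (@subsetUr _ _ _)).
  by move=> q qs; apply: sX; rewrite inE qs orbT.
Qed.

End Scattered.

(** * Coverings by finitely many flats *)

Section Flats.
Context {R : realType} {V : lmodType R}.
Implicit Types (p v w x y : V) (vs us : seq V) (X Z : set V) (k : nat).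

(** The linear span, one coefficient per vector. Dependent vectors are allowed, so the length only
    bounds the dimension from above. *)
Fixpoint lspan vs : set V :=
  if vs is v :: vs' then [set x | exists t : R, lspan vs' (x - t *: v)] else [set 0].

Lemma lspan0 vs : lspan vs 0.
Proof. by elim: vs => //= v vs IH; exists 0; rewrite scale0r subr0. Qed.

Lemma lspanD vs x y : lspan vs x -> lspan vs y -> lspan vs (x + y).
Proof.
elim: vs x y => [x y -> ->|v vs IH x y [t xt] [u yu]] /=; first by rewrite addr0.
by exists (t + u); rewrite scalerDl opprD addrACA; exact: IH.
Qed.

Lemma lspanZ vs (c : R) x : lspan vs x -> lspan vs (c *: x).
Proof.
elim: vs x => [x ->|v vs IH x [t xt]] /=; first by rewrite scaler0.
by exists (c * t); rewrite -scalerA -scalerBr; exact: IH.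
Qed.

Lemma lspanB vs x y : lspan vs x -> lspan vs y -> lspan vs (x - y).
Proof. by move=> sx sy; rewrite -scaleN1r; apply/lspanD/lspanZ. Qed.

Lemma lspan_cons v vs : lspan vs `<=` lspan (v :: vs).
Proof. by move=> x sx; exists 0; rewrite scale0r subr0. Qed.

Lemma mem_lspan v vs : v \in vs -> lspan vs v.
Proof.
elim: vs => // w vs IH; rewrite inE => /orP[/eqP->|/IH]; last exact: lspan_cons.
by exists 1; rewrite scale1r subrr; exact: lspan0.
Qed.

Lemma lspanS vs us : {subset vs <= us} -> lspan vs `<=` lspan us.
Proof.
elim: vs => [_ x ->|v vs IH vus x [t xt]]; first exact: lspan0.
rewrite -[x](subrK (t *: v)); apply: lspanD.
  by apply: IH xt => y yvs; apply: vus; rewrite inE yvs orbT.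
by apply/lspanZ/mem_lspan/vus; rewrite inE eqxx.
Qed.

Definition flat p vs : set V := [set x | lspan vs (x - p)].

Definition flat_covered k Z := exists s : seq (V * seq V),
  (forall q, q \in s -> size q.2 = k) /\
  Z `<=` \bigcup_(q in [set q | q \in s]) flat q.1 q.2.

Lemma flat_coveredS k Z Z' : Z `<=` Z' -> flat_covered k Z' -> flat_covered k Z.
Proof. by move=> ZZ' [s [sk Z's]]; exists s; split=> //; exact: subset_trans Z's. Qed.

Lemma flat_covered0 k : flat_covered k set0.
Proof. by exists [::]; split. Qed.

Lemma flat_coveredU k Z Z' :
  flat_covered k Z -> flat_covered k Z' -> flat_covered k (Z `|` Z').
Proof.
move=> [s [sk Zs]] [s' [s'k Z's']]; exists (s ++ s'); split.
  by move=> q; rewrite mem_cat => /orP[/sk|/s'k].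
move=> x [/Zs|/Z's'] [q /= qs qx]; exists q => //=; rewrite mem_cat qs ?orbT //.
Qed.

Lemma flat_covered_flat p vs : flat_covered (size vs) (flat p vs).
Proof.
exists [:: (p, vs)]; split; first by move=> q; rewrite inE => /eqP->.
by move=> x px; exists (p, vs) => //=; rewrite inE.
Qed.

(** Each list of directions is padded with a zero vector. *)
Lemma flat_covered_step k Z : flat_covered k Z -> flat_covered k.+1 Z.
Proof.
move=> [s [sk Zs]]; exists [seq (q.1, 0 :: q.2) | q <- s]; split.
  by move=> _ /mapP[q /sk <- ->].
move=> x /Zs[q /= qs qx]; exists (q.1, 0 :: q.2) => /=; first by apply/mapP; exists q.
exact: lspan_cons.
Qed.

Lemma flat_covered_pieces k Z :
  (exists s : seq (V * seq V),
    (forall q, q \in s -> flat_covered k (Z `&` flat q.1 q.2)) /\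
    Z `<=` \bigcup_(q in [set q | q \in s]) flat q.1 q.2) ->
  flat_covered k Z.
Proof.
move=> [s [sk Zs]]; rewrite -(setIidl Zs).
elim: s {Zs} sk => [|q s IH] sk.
  by apply: flat_coveredS (@flat_covered0 k) => x [_ []].
apply: (@flat_coveredS _ _ ((Z `&` flat q.1 q.2) `|`
    (Z `&` \bigcup_(r in [set r | r \in s]) flat r.1 r.2))).
  move=> x [Zx [r /=]]; rewrite inE => /orP[/eqP->|rs] rx; [left | right] => //.
  by split=> //; exists r.
apply: flat_coveredU; first by apply: sk; rewrite inE eqxx.
by apply: IH => r rs; apply: sk; rewrite inE rs orbT.
Qed.

(** * Points in convex position *)

(** The span of the other terms is the separating convex set: if it contained [x n], the last term
    in the dependence would lie in the span of its predecessors. *)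
Lemma free_convex_position (x : nat -> V) :
  (forall n, ~ lspan (past x n) (x n)) -> convex_position x.
Proof.
move=> x_free n; pose L N := [seq x i | i <- past id N & i != n].
have mem_past_id i N : i \in past id N -> (i < N)%N.
  elim: N => //= N IH; rewrite inE => /orP[/eqP->//|/IH iN]; exact: ltnW.
have LS N M : (N <= M)%N -> lspan (L N) `<=` lspan (L M).
  move=> NM; apply: lspanS => y /mapP[i + ->]; rewrite mem_filter => /andP[i_n iN].
  apply: map_f; rewrite mem_filter i_n (mem_past id) //.
  exact: leq_trans (mem_past_id _ _ iN) NM.
have L_past N M : (N <= M)%N -> lspan (L N) `<=` lspan (past x M).
  move=> NM; apply: lspanS => y /mapP[i + ->]; rewrite mem_filter => /andP[_ iN].
  exact: mem_past (leq_trans (mem_past_id _ _ iN) NM).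
exists (\bigcup_N lspan (L N)); split.
- apply/convex_setP => y z t _ _ [N _ yN] [M _ zM]; exists (maxn N M) => //.
  apply: lspanD; apply: lspanZ.
    by apply: LS yN; rewrite leq_maxl.
  by apply: LS zM; rewrite leq_maxr.
- move=> [N _]; elim: N => [/(L_past _ n (leq0n _))/x_free//|N IH].
  have [Nn /(L_past _ _ Nn)/x_free//|nN] := leqP N.+1 n.
  rewrite /L /=; have [->|N_n] /= := eqVneq N n.
    by move=> /(L_past _ _ (leqnn _))/x_free.
  move=> [t]; have [->|t0] := eqVneq t 0; first by rewrite scale0r subr0.
  move=> /(L_past _ _ (leqnn _)) xr; apply: (x_free N).
  have -> : x N = t^-1 *: (x n - (x n - t *: x N)).
    by rewrite subKr scalerA mulVf // scale1r.
  apply/lspanZ/lspanB => //; apply/mem_lspan/mem_past.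
  by rewrite ltn_neqAle eq_sym N_n.
- move=> m mn; exists m.+1 => //; apply: mem_lspan; apply: map_f.
  by rewrite mem_filter mn mem_past.
Qed.

End Flats.

(** * Ramsey's theorem for triples along a filter *)

Lemma filter_forall_in (T : Type) (E : eqType) (F : set_system T) {FF : Filter F}
    (s : seq E) (G : E -> T -> Prop) :
  (forall x, x \in s -> F [set z | G x z]) ->
  F [set z | forall x, x \in s -> G x z].
Proof.
elim: s => [|x s IH] sG; first by apply: filterS filterT => z _ x.
have Fs : F [set z | forall x, x \in s -> G x z].
  by apply: IH => y ys; apply: sG; rewrite inE ys orbT.
have Fx : F [set z | G x z] by apply: sG; rewrite inE eqxx.
apply: filterS (filterI Fs Fx) => z [zs zx] y; rewrite inE => /orP[/eqP->//|].
exact: zs.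
Qed.

(* A filter version of the infinite Ramsey theorem for triples. *)
Lemma filter_triples (T : eqType) (F : set_system T) (Y : set T)
    (P : T -> T -> T -> Prop) : ProperFilter F -> F Y ->
  F [set x | F [set y | F [set z | P x y z]]] ->
  exists u : nat -> T, (forall n, Y (u n)) /\
    forall i j k, (i < j < k)%N -> P (u i) (u j) (u k).
Proof.
move=> FF FY FP; pose P2 x y := F [set z | P x y z]; pose P1 x := F [set y | P2 x y].
pose fix tri z s := if s is y :: s' then (forall x, x \in s' -> P x y z) /\ tri z s'
  else True.
(* Every term and pair so far stays generic for [F] and every triple satisfies [P], so the next term
   is found in a finite intersection of sets of [F]. *)
pose fix good s := if s is z :: s' then
  [/\ good s', Y z, P1 z, (forall x, x \in s' -> P2 x z) & tri z s'] else True.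
have [//|s gs|u goodu] := @greedy_sequence _ good.
  have P1s x : x \in s -> P1 x.
    elim: s gs => // y s IH [gs _ Py _ _]; rewrite inE => /orP[/eqP->//|]; exact: IH.
  have Ftri : F [set z | tri z s].
    elim: s gs {P1s} => [_|y s IH [gs _ _ sy _]] /=; first exact: filterT.
    have Fy : F [set z | forall x, x \in s -> P x y z].
      exact: (@filter_forall_in _ _ F _ s (fun x z => P x y z)).
    by apply: filterS (filterI Fy (IH gs)) => z [].
  have F2 : F [set z | forall x, x \in s -> P2 x z].
    exact: (@filter_forall_in _ _ F _ s P2).
  have [z [[[Yz P1z] Pz] triz]] := filter_ex (filterI (filterI (filterI FY FP) F2) Ftri).
  by exists z.
exists u; split=> [n|i j k /andP[ij jk]]; first by have [] := goodu n.+1.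
have [_ _ _ _] := goodu k.+1; move: (u k) => z.
elim: k jk => // k IH; rewrite ltnS leq_eqVlt => /orP[/eqP <-|/IH jk] [tk tri_k].
  exact/tk/mem_past.
exact: jk.
Qed.

(** * Plane coordinates, orientation and convex position *)

Section Planar.
Context {R : realType} {V : lmodType R}.
Implicit Types (p v w x y : V) (vs us : seq V) (X Z : set V) (k : nat).

(* Twice the signed area of the triangle [P Q S]. *)
Definition orient (P Q S : R * R) : R :=
  (Q.1 - P.1) * (S.2 - P.2) - (S.1 - P.1) * (Q.2 - P.2).

(* If every increasing triple has the same orientation, the lines through
   [u n, u n.+1] and through [u n.+1, u n.+2] both support the sequence; adding
   their equations gives an affine function vanishing at [u n.+1] and positive
   at all other points. *)
Lemma oriented_separation (u : nat -> R * R) (e : R) :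
  (forall i j k, (i < j < k)%N -> 0 < e * orient (u i) (u j) (u k)) ->
  forall n m, m != n ->
  0 < e * (orient (u n) (u n.+1) (u m.+1) + orient (u n.+1) (u n.+2) (u m.+1)).
Proof.
move=> pos n m mn.
have cyc P Q S : orient P Q S = orient Q S P by rewrite /orient; ring.
have degl P Q : orient P Q P = 0 by rewrite /orient; ring.
have degr P Q : orient P Q Q = 0 by rewrite /orient; ring.
rewrite mulrDr; have [lt_mn|lt_nm|/eqP] := ltngtP m n; last by rewrite (negPf mn).
  have pos2 : 0 < e * orient (u n.+1) (u n.+2) (u m.+1).
    by rewrite -cyc; apply: pos; rewrite ltnS lt_mn ltnSn.
  have [mn1|ne] := eqVneq m.+1 n; first by subst n; rewrite degl mulr0 add0r.
  apply: addr_gt0 => //; rewrite -cyc; apply: pos.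
  by rewrite ltn_neqAle ne lt_mn ltnSn.
have pos1 : 0 < e * orient (u n) (u n.+1) (u m.+1).
  by apply: pos; rewrite ltnSn ltnS.
have [mn1|ne] := eqVneq m n.+1; first by subst m; rewrite degr mulr0 addr0.
apply: addr_gt0 => //; apply: pos.
by rewrite ltnSn /= ltnS ltn_neqAle eq_sym ne.
Qed.

Lemma orient0_line (P Q S : R * R) : orient P Q S = 0 -> Q <> P ->
  exists t, S = (P.1 + t * (Q.1 - P.1), P.2 + t * (Q.2 - P.2)).
Proof.
case: P Q S => [p1 p2] [q1 q2] [s1 s2]; rewrite /orient /= => o0 QP.
have [d1|d1] := eqVneq (q1 - p1) 0; last first.
  exists ((s1 - p1) / (q1 - p1)); rewrite divfK // addrC subrK; congr pair.
  apply/eqP; rewrite addrC -subr_eq mulrAC; apply/eqP/(canRL (mulfK d1)).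
  by apply/eqP; rewrite -subr_eq0 -o0; apply/eqP; ring.
have [d2|d2] := eqVneq (q2 - p2) 0; first by case: QP; rewrite (subr0_eq d1) (subr0_eq d2).
exists ((s2 - p2) / (q2 - p2)); rewrite divfK // [p2 + _]addrC subrK; congr pair.
apply/eqP; rewrite addrC -subr_eq mulrAC; apply/eqP/(canRL (mulfK d2)).
by apply/eqP; rewrite -subr_eq0 -oppr0 -o0; apply/eqP; ring.
Qed.

Section Coordinates.
Variables (p v w : V) (us : seq V).

Let pt (a b : R) : V := a *: v + b *: w.

Let ptD a b a' b' : pt (a + a') (b + b') = pt a b + pt a' b'.
Proof. by rewrite /pt !scalerDl addrACA. Qed.

Let ptZ t a b : pt (t * a) (t * b) = t *: pt a b.
Proof. by rewrite /pt scalerDr !scalerA. Qed.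

(** Coordinates along [v] and [w] modulo the span of [us]. This is a relation because they are not
    unique when [v] and [w] are dependent modulo that span. *)
Definition coords x (d : R * R) := lspan us (x - (p + pt d.1 d.2)).

Lemma flat_coords x : flat p (v :: w :: us) x <-> exists d, coords x d.
Proof.
have E a b : x - p - a *: v - b *: w = x - (p + pt a b) by rewrite /pt !opprD !addrA.
by split=> [[a [b]]|[[a b]]]; rewrite /coords ?E /=; [exists (a, b) | exists a, b; rewrite E].
Qed.

Lemma coords_conv x y d d' (t : R) : coords x d -> coords y d' ->
  coords (t *: x + (1 - t) *: y)
         (t * d.1 + (1 - t) * d'.1, t * d.2 + (1 - t) * d'.2).
Proof.
move=> xd yd; rewrite /coords /= ptD !ptZ.
have E (q q' : V) : p + (t *: q + (1 - t) *: q') = t *: (p + q) + (1 - t) *: (p + q').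
  by rewrite !scalerDr addrACA -scalerDl [t + _]addrC subrK scale1r.
rewrite E opprD addrACA -!scalerBr; apply: lspanD; exact: lspanZ.
Qed.

Lemma coords_line x z (d d' : R * R) (t : R) : coords x d ->
  coords z (d.1 + t * d'.1, d.2 + t * d'.2) ->
  flat (p + pt d.1 d.2) (pt d'.1 d'.2 :: us) z.
Proof. by move=> xd; rewrite /coords /= ptD ptZ addrA opprD addrA => zd; exists t. Qed.

(** A fibre of the projection is a translate of the span of [us]; [v] pads the directions to the
    length wanted for coverings. *)
Lemma coords_same z d : coords z d -> flat (p + pt d.1 d.2) (v :: us) z.
Proof. exact: lspan_cons. Qed.

(** Two coordinate pairs of one point give a non-trivial combination of [v] and [w] in the span of
    [us], which eliminates one direction and makes the flat too small. *)
Lemma coords_unique k x d d' : size us = k ->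
  ~ flat_covered k.+1 (flat p (v :: w :: us)) -> coords x d -> coords x d' -> d = d'.
Proof.
move=> sk big xd xd'.
have kersp : lspan us (pt (d.1 - d'.1) (d.2 - d'.2)).
  have -> : pt (d.1 - d'.1) (d.2 - d'.2) = (x - (p + pt d'.1 d'.2)) - (x - (p + pt d.1 d.2)).
    rewrite opprB [RHS]addrC addrA subrK opprD addrACA subrr add0r.
    by rewrite ptD -[- d'.1]mulN1r -[- d'.2]mulN1r ptZ scaleN1r.
  exact: lspanB.
(* Coordinates may be shifted by any multiple of the difference; the multiple is chosen below to
   cancel one of them. *)
have shrink z : flat p (v :: w :: us) z -> exists d0 : R * R,
    forall t, coords z (d0.1 - t * (d.1 - d'.1), d0.2 - t * (d.2 - d'.2)).
  move=> /flat_coords[d0 zd0]; exists d0 => t; rewrite /coords /= -!mulNr ptD ptZ.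
  rewrite addrA opprD addrA scaleNr opprK; apply: lspanD => //; exact: lspanZ.
have [d1|d1] := eqVneq d.1 d'.1; last first.
  case: big; apply: (@flat_coveredS _ _ _ _ (flat p (w :: us))).
    2: by rewrite -sk; exact: flat_covered_flat (w :: us).
  move=> z /shrink[d0 /(_ (d0.1 / (d.1 - d'.1)))].
  rewrite divfK ?subr_eq0 // subrr /coords /pt /= scale0r add0r opprD addrA => zd0.
  by exists (d0.2 - d0.1 / (d.1 - d'.1) * (d.2 - d'.2)).
have [d2|d2] := eqVneq d.2 d'.2; first by rewrite (surjective_pairing d) d1 d2 -surjective_pairing.
case: big; apply: (@flat_coveredS _ _ _ _ (flat p (v :: us))).
  2: by rewrite -sk; exact: flat_covered_flat (v :: us).
move=> z /shrink[d0 /(_ (d0.2 / (d.2 - d'.2)))].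
rewrite divfK ?subr_eq0 // subrr /coords /pt /= scale0r addr0 opprD addrA => zd0.
by exists (d0.1 - d0.2 / (d.2 - d'.2) * (d.1 - d'.1)).
Qed.

End Coordinates.

(* Project the flat to the plane spanned by two of its directions.  An
   ultrafilter avoiding all flats of lower dimension sees three generic points
   as non-collinear, with a constant orientation. *)
Lemma flat_convex_position k p vs Z : size vs = k.+2 -> Z `<=` flat p vs ->
  ~ flat_covered k.+1 Z ->
  exists x : nat -> V, (forall n, Z (x n)) /\ convex_position x.
Proof.
case: vs => [|v [|w us]] //= -[sk] Zflat Zbig.
have flat_big : ~ flat_covered k.+1 (flat p (v :: w :: us)).
  by move=> c; apply/Zbig/(flat_coveredS Zflat).
have covk q r : flat_covered k.+1 (flat q (r :: us)).
  by rewrite -sk; exact: flat_covered_flat (r :: us).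
(* The sets containing [Z] up to finitely many smaller flats; this filter is proper because [Z] is
   not so covered. *)
pose F0 := [set A : set V | flat_covered k.+1 (Z `\` A)].
have PF0 : ProperFilter F0.
  split; first by rewrite /F0 /= setD0.
  split.
  - by rewrite /F0 /= setDT; exact: flat_covered0.
  - by move=> A B FA FB; rewrite /F0 /= setDIr; exact: flat_coveredU.
  - by move=> A B AB; apply: flat_coveredS; exact: setDS.
have [U [UU F0U]] := ultraFilterLemma PF0.
have UZ : U Z by apply: F0U; rewrite /F0 /= setDv; exact: flat_covered0.
have Uflat q r : U (~` flat q (r :: us)).
  apply: F0U; apply: flat_coveredS (covk q r) => x [_ nnx].
  exact: contrapT.
have /choice[c cP] x : exists d, Z x -> coords p v w us x d.
  have [Zx|nZx] := pselect (Z x); last by exists 0.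
  by have /flat_coords[d xd] := Zflat _ Zx; exists d.
have U_ne x : Z x -> U [set y | c y <> c x].
  move=> Zx; apply: filterS (filterI UZ (Uflat (p + ((c x).1 *: v + (c x).2 *: w)) v)).
  by move=> y [Zy nxy] cyx; apply: nxy; rewrite -cyx; apply/coords_same/cP.
have U_or x y : Z x -> c y <> c x -> U [set z | orient (c x) (c y) (c z) != 0].
  move=> Zx cyx; pose d' := ((c y).1 - (c x).1, (c y).2 - (c x).2).
  apply: filterS (filterI UZ (Uflat (p + ((c x).1 *: v + (c x).2 *: w))
    (d'.1 *: v + d'.2 *: w))) => z [Zz nz]; apply/eqP => oz; apply: nz.
  have [t zt] : exists t, c z = ((c x).1 + t * d'.1, (c x).2 + t * d'.2). exact: orient0_line.
  by apply: (@coords_line _ _ _ _ x z _ _ t (cP _ Zx)); rewrite -zt; exact: cP.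
have [e [u [Zu upos]]] : exists (e : R) (u : nat -> V), (forall n, Z (u n)) /\
    forall i j l, (i < j < l)%N -> 0 < e * orient (c (u i)) (c (u j)) (c (u l)).
  (* The ultrafilter decides the sign of a generic triple; where it is not positive,
     non-collinearity makes it negative. *)
  have [Upos|Uneg] := in_ultra_setVsetC
      [set x | U [set y | U [set z | 0 < orient (c x) (c y) (c z)]]] UU.
    exists 1; have [|u [Zu uP]] := @filter_triples _ U Z
      (fun x y z => 0 < 1 * orient (c x) (c y) (c z)) _ UZ; last by exists u.
    apply: filterS Upos => x; apply: filterS => y; apply: filterS => z /=.
    by rewrite mul1r.
  exists (-1); have [|u [Zu uP]] := @filter_triples _ U Z
    (fun x y z => 0 < -1 * orient (c x) (c y) (c z)) _ UZ; last by exists u.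
  apply: filterS (filterI UZ Uneg) => x [Zx /= nx].
  have Unx : U (~` [set y | U [set z | 0 < orient (c x) (c y) (c z)]]).
    by case: (in_ultra_setVsetC [set y | U [set z | 0 < orient (c x) (c y) (c z)]] UU).
  apply: filterS (filterI (U_ne _ Zx) Unx) => y [/= cyx ny].
  have Uny : U (~` [set z | 0 < orient (c x) (c y) (c z)]).
    by case: (in_ultra_setVsetC [set z | 0 < orient (c x) (c y) (c z)] UU).
  apply: filterS (filterI (U_or _ _ Zx cyx) Uny) => z [/= oz /negP].
  by rewrite -leNgt => oz'; rewrite mulN1r oppr_gt0 lt_neqAle oz.
(* The first term is dropped so that each remaining one has a predecessor, as the supporting
   function [phi] needs both neighbours. *)
exists (fun n => u n.+1); split=> [n|n]; first exact: Zu.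
pose phi d := e * (orient (c (u n)) (c (u n.+1)) d + orient (c (u n.+1)) (c (u n.+2)) d).
have phi0 : phi (c (u n.+1)) = 0 by rewrite /phi /orient; ring.
(* The separating convex set is the preimage of the open half-plane where [phi] is positive. *)
exists [set x | exists2 d, coords p v w us x d & 0 < phi d]; split.
- apply/convex_setP => x y t t0 t1 [d xd d0] [d' yd d'0].
  exists (t * d.1 + (1 - t) * d'.1, t * d.2 + (1 - t) * d'.2); first exact: coords_conv.
  have -> : phi (t * d.1 + (1 - t) * d'.1, t * d.2 + (1 - t) * d'.2) =
      t * phi d + (1 - t) * phi d' by rewrite /phi /orient /=; ring.
  have [->|tn0] := eqVneq t 0; first by rewrite mul0r add0r subr0 mul1r.
  apply: ltr_pwDl; first by rewrite mulr_gt0 // lt_neqAle eq_sym tn0.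
  by rewrite mulr_ge0 ?subr_ge0 // ltW.
- move=> [d xd]; rewrite (coords_unique sk flat_big xd (cP _ (Zu n.+1))) phi0.
  by rewrite ltxx.
- move=> m mn; exists (c (u m.+1)); first exact/cP/Zu.
  exact: (@oriented_separation (c \o u)).
Qed.

(** * Coverings by finitely many lines and the orders on them *)

Lemma no_Pfin_flat_covered1 X :
  ~ has_Pfin_nat (compact_elts (Co X)) -> flat_covered 1 X.
Proof.
move=> noP.
have no_cp (x : nat -> V) : (forall n, X (x n)) -> ~ convex_position x.
  by move=> Xx cpx; exact/noP/(convex_position_Pfin Xx cpx).
(* Otherwise no finite list spans [X], and a linearly independent sequence is picked from it
   greedily. *)
have [k Xk] : exists k, flat_covered k X.
  apply: contrapT => /forallNP big.
  pose good s := if s is x :: s' then X x /\ ~ lspan s' x else True.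
  have [//|s _|x xP] := @greedy_sequence _ good.
    apply: contrapT => /forallNP nex; apply: (big (size s)).
    apply: flat_coveredS (flat_covered_flat 0 s) => x Xx.
    by rewrite /flat /= subr0; apply: contrapT => nsx; exact: (nex x).
  apply: (no_cp x) => [n|]; first by have [] := xP n.+1.
  by apply: free_convex_position => n; have [] := xP n.+1.
(* Raised by one so that the descent to 1 also covers [k = 0]; each descent step replaces the trace
   on every flat by smaller flats. *)
have {}Xk : flat_covered k.+1 X by exact: flat_covered_step.
elim: k Xk => [//|k IH [s [sk Xs]]]; apply: IH.
apply: flat_covered_pieces; exists s; split=> // q qs; apply: contrapT => big.
have [x [Zx cpx]] := flat_convex_position (sk _ qs) (@subIsetr _ X _) big.
by apply: (no_cp x) => // n; have [] := Zx n.
Qed.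

Lemma line_order_scattered X (a v : V) : v != 0 ->
  order_scattered (@subset V) (compact_elts (Co X)) ->
  order_scattered (fun t u : R => t <= u) [set t : R | X (a + t *: v)].
Proof.
move=> v0 sS [f [fX fle]]; apply: sS.
(* An increasing map of [rat] into the positive rationals, so that all points [f (h q)] lie beyond
   the common endpoint [f 0]. *)
pose h (q : rat) : rat := if 0 <= q then q + 1 else (1 - q)^-1.
have h_gt0 q : 0 < h q.
  rewrite /h; case: (leP 0 q) => q0; first by lra.
  by rewrite invr_gt0; lra.
have h_homo : {homo h : q r / q < r}.
  move=> q r qr; rewrite /h; case: (leP 0 q) => q0; case: (leP 0 r) => r0; try lra.
    have : (1 - q)^-1 < 1 by rewrite invf_lt1; lra.
    lra.
  by rewrite ltf_pV2 ?posrE; lra.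
have h_le := le_mono h_homo.
have f_lt q r : q < r -> f q < f r by rewrite !ltNge => /negP qr; apply/negP => /fle.
pose pos (t : R) : V := a + t *: v.
pose K q := hull [set z | z = pos (f 0) \/ z = pos (f (h q))] `&` X.
have Kx0 q : K q (pos (f 0)) by split; [apply: sub_hull; left | exact: fX].
have Kx q : K q (pos (f (h q))) by split; [apply: sub_hull; right | exact: fX].
exists K; split=> [q|q r].
  apply: compact_hull; last by move=> z [->|->]; exact: fX.
  have -> : [set z | z = pos (f 0) \/ z = pos (f (h q))] = [set pos (f 0); pos (f (h q))] by [].
  by rewrite finite_setU; split; exact: finite_set1.
have xE s t : pos t = pos s + (t - s) *: v.
  by rewrite /pos -addrA -scalerDl [s + _]addrC subrK.
split=> [qr|].
  have fhr : f (h q) <= f (h r) by apply/fle; rewrite h_le.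
  have f0q : f 0 <= f (h q) by apply/fle; rewrite ltW.
  suff Kr : K r (pos (f (h q))).
    apply: setISS => //; apply: hull_min; first exact: hull_convex.
    by move=> z [->|->]; [have [] := Kx0 r | have [] := Kr].
  rewrite (xE (f 0)); apply: (@Co_segment _ _ X _ _ _ (f (h r) - f 0)).
  - exact: Co_hull.
  - exact: Kx0.
  - by rewrite -xE.
  - by rewrite subr_ge0.
  - by rewrite lerD2r.
  - by rewrite -xE; exact: fX.
move=> Kqr; rewrite leNgt; apply/negP => rq.
(* [K r] stays in the half-line ending at [f (h r)], which is convex and misses the far endpoint of
   [K q]. *)
suff : K r `<=` [set z | exists2 t, t <= f (h r) & z = pos t].
  move=> /(_ _ (Kqr _ (Kx q)))[t tr xt].
  have : (f (h q) - t) *: v = 0.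
    by move: xt; rewrite (xE t (f (h q))) => /(canRL (addKr _)); rewrite addNr.
  move=> /eqP; rewrite scaler_eq0 (negPf v0) orbF subr_eq0 => /eqP qt.
  by have := f_lt _ _ (h_homo _ _ rq); rewrite qt ltNge tr.
move=> y [hy _]; apply: hull_min hy.
  apply/convex_setP => _ _ t t0 t1 [s1 s1r ->] [s2 s2r ->].
  exists (t * s1 + (1 - t) * s2).
    have : t * s1 + (1 - t) * s2 <= t * f (h r) + (1 - t) * f (h r).
      by apply: lerD; apply: ler_wpM2l; rewrite ?subr_ge0.
    by rewrite -mulrDl [t + _]addrC subrK mul1r.
  rewrite /pos !scalerDr addrACA -scalerDl [t + _]addrC subrK scale1r.
  by rewrite !scalerA -scalerDl.
move=> _ [->|->]; last by exists (f (h r)).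
by exists (f 0) => //; apply/fle; rewrite ltW.
Qed.

End Planar.

Theorem theorem5p1 (R : realType) (V : lmodType R) (X : set V)
    (Vnontriv : exists v : V, v != 0) :
  let L := Co X in
  let S := compact_elts L in
  [<-> top_scattered X L;
       order_scattered (@subset V) L;
       order_scattered (@subset V) S /\ ~ has_Pfin_nat S;
       finite_lines_scattered X].
Proof.
move=> L S; split; first exact: top_scattered_order.
split.
  move=> sL; split; last exact: order_scattered_no_Pfin.
  by move=> [f [fS fle]]; apply: sL; exists f; split=> // q; have [] := fS q.
split; last exact: lines_top_scattered.
move=> [sS noP]; have [s [s1 Xs]] := no_Pfin_flat_covered1 noP.
have [v0 v0_neq0] := Vnontriv.
(* A flat with zero direction is a single point; [v0] turns it into a genuine line through that
   point. *)
pose dir (vs : seq V) := if head 0 vs == 0 then v0 else head 0 vs.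
have dir_neq0 vs : dir vs != 0 by rewrite /dir; case: ifPn.
exists [seq (q.1, dir q.2) | q <- s]; split.
- by move=> _ /mapP[q _ ->]; exact: dir_neq0.
- move=> x /Xs[[p vs] /= qs qx]; exists (p, dir vs) => /=.
    by apply/mapP; exists (p, vs).
  have := s1 _ qs; case: vs qx {qs} => [|v [|]] //= [t /= xt] _.
  have {}xt : x = p + t *: v.
    by move/eqP: xt; rewrite subr_eq0 subr_eq addrC => /eqP.
  rewrite /dir /=; have [v_0|_] := eqVneq v 0; last by exists t; rewrite ?xt.
  by exists 0 => //; rewrite xt v_0 scaler0 scale0r.
- move=> _ /mapP[q _ ->]; exact: line_order_scattered (dir_neq0 _) sS.
Qed.
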